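(* Let $(T,q,0,w)$ be basic data (with trace $0$) whose rule $w$ has invertible corners, and let $\Lambda=\Lambda(T,q,0,w)$ be the associated $2$-graph. Let $\Lambda^\Delta$ be its two-sided infinite path space with shift action $\sigma$ of $\mathbb Z^2$, and let $\Omega$ be the shift space $$\Omega=\Big\{f:\mathbb Z^2\to\mathbb Z/q\mathbb Z:\ \sum_{i\in T}w(i)f(i+n)=0\ \text{ for all } n\in\mathbb Z^2\Big\}$$ with the action $\alpha$ of $\mathbb Z^2$ given by $(\alpha_pf)(n)=f(n+p)$. Then there is a homeomorphism $h:\Lambda^\Delta\to\Omega$ such that $\alpha_p\circ h=h\circ\sigma_p$ for all $p\in\mathbb Z^2$.
   Context: $\mathbb N=\{0,1,2,\dots\}$; $e_1,e_2$ is the usual basis of $\mathbb Z^2$; $m\le n$ in $\mathbb Z^2$ is meant coordinatewise. A tile is a finite subset $T\subset\mathbb N^2$ containing $0$ which is hereditary ($j\in T$ and $0\le i\le j$ imply $i\in T$). Basic data $(T,q,t,w)$ consist of a tile $T$, an integer $q\ge 2$, an element $t\in\mathbb Z/q\mathbb Z$ (the trace) and a function $w:T\to\mathbb Z/q\mathbb Z$ (the rule). Let $(c_1,c_2)$ be the coordinatewise maximum of the elements of $T$. The rule $w$ has invertible corners if $w(c_1e_1)$ and $w(c_2e_2)$ are invertible in $\mathbb Z/q\mathbb Z$. The vertex set is $\Lambda^0=\{v:T\to\mathbb Z/q\mathbb Z:\sum_{i\in T}w(i)v(i)=t\}$. For $n\in\mathbb N^2$ put $T(n)=\bigcup_{0\le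 m\le n}(T+m)$. If $f$ is a $\mathbb Z/q\mathbb Z$-valued function whose domain contains $T+n$, define $f|_{T+n}:T\to\mathbb Z/q\mathbb Z$ by $f|_{T+n}(i)=f(i+n)$. A path of degree $n$ is a function $\lambda:T(n)\to\mathbb Z/q\mathbb Z$ such that $\lambda|_{T+m}\in\Lambda^0$ for all $0\le m\le n$; $\Lambda^n$ is the set of these. The source and range of $\lambda\in\Lambda^n$ are $s(\lambda)=\lambda|_{T+n}$ and $r(\lambda)=\lambda|_T$. For $\lambda\in\Lambda^p$ and $0\le m\le n\le p$, the segment $\lambda(m,n)\in\Lambda^{n-m}$ is $\lambda(m,n)(i)=\lambda(m+i)$ for $i\in T(n-m)$. If $w$ has invertible corners, then for $\mu\in\Lambda^m$, $\nu\in\Lambda^n$ with $s(\mu)=r(\nu)$ there is a unique $\mu\nu\in\Lambda^{m+n}$ with $(\mu\nu)(0,m)=\mu$ and $(\mu\nu)(m,m+n)=\nu$; with this composition, objects $\Lambda^0$, morphisms $\bigcup_n\Lambda^n$ and degree map $d(\lambda)=n$ for $\lambda\in\Lambda^n$, one obtains a $2$-graph $\Lambda(T,q,t,w)$. Let $\Delta=\{(m,n):m,n\in\mathbb Z^2,\ m\le n\}$, a $2$-graph (category) with objects $\mathbb Z^2$, $r(m,n)=m$, $s(m,n)=n$, $(m,n)(n,p)=(m,p)$, $d(m,n)=n-m$. The two-sided infinite path space is $\Lambda^\Delta=\{x:\Delta\to\Lambda: x\text{ is a degree-preserving functor}\}$, with the topology having basic open sets $Z(\lambda,n)=\{x\in\Lambda^\Delta:x(n,n+d(\lambda))=\lambda\}$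 for $\lambda\in\Lambda$, $n\in\mathbb Z^2$. For $p\in\mathbb Z^2$, $\sigma_p(x)(m,n)=x(m+p,n+p)$. The space $\Omega\subset(\mathbb Z/q\mathbb Z)^{\mathbb Z^2}$ has the (relative) product topology. *)

(* Defs.v *)
From HB Require Import structures.
From mathcomp Require Import all_boot all_order all_algebra.
From mathcomp Require Import finmap.
From mathcomp Require Import mathcomp_extra boolp classical_sets functions.
From mathcomp Require Import topology.

Set Implicit Arguments.
Unset Strict Implicit.
Unset Printing Implicit Defensive.

Import Order.TTheory GRing.Theory Num.Theory.

Local Open Scope classical_set_scope.
Local Open Scope ring_scope.

Definition homeomorphism (X Y : topologicalType) (h : X -> Y) : Prop :=
  continuous h /\
  exists g : Y -> X, [/\ cancel h g, cancel g h & continuous g].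

(* Coordinatewise order and (truncated) subtraction on N^2; addition on
   [nat * nat] and the group structure of [int * int] are MathComp's. *)
Definition le2 (m n : nat * nat) : bool := (m.1 <= n.1)%N && (m.2 <= n.2)%N.
Definition sub2 (n m : nat * nat) : nat * nat := (n.1 - m.1, n.2 - m.2)%N.
Definition lez2 (m n : int * int) : bool := (m.1 <= n.1) && (m.2 <= n.2).
Definition intz2 (i : nat * nat) : int * int := (i.1%:Z, i.2%:Z).

Lemma le02 n : le2 0 n. Proof. by []. Qed.
Lemma le2_refl n : le2 n n. Proof. by rewrite /le2 !leqnn. Qed.
Lemma le2_addr m n : le2 m (m + n). Proof. by rewrite /le2 !leq_addr. Qed.

(* The data of a 2-graph: a small category, given by its objects and the
   totality of its morphisms, and its degree map.  [comp2 a b] is the composite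
   "a b" of a and b, defined when src2 a = rng2 b. *)
Record graph2 := Graph2 {
  ob2 : Type;
  mor2 : Type;
  rng2 : mor2 -> ob2;
  src2 : mor2 -> ob2;
  id2 : ob2 -> mor2;
  comp2 : mor2 -> mor2 -> option mor2;
  deg2 : mor2 -> nat * nat
}.

Record dfunctor (C D : graph2) := DFunctor {
  fob : ob2 C -> ob2 D;
  fmor :> mor2 C -> mor2 D;
  fmor_rng : forall a, rng2 (fmor a) = fob (rng2 a);
  fmor_src : forall a, src2 (fmor a) = fob (src2 a);
  fmor_id : forall v, fmor (id2 v) = id2 (fob v);
  fmor_comp : forall a b c,
    comp2 a b = Some c -> comp2 (fmor a) (fmor b) = Some (fmor c);
  fmor_deg : forall a, deg2 (fmor a) = deg2 a
}.

Definition delta_mor : Type := {p : (int * int) * (int * int) | lez2 p.1 p.2}.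

Definition delta_rng (a : delta_mor) : int * int := (val a).1.
Definition delta_src (a : delta_mor) : int * int := (val a).2.
Definition delta_deg (a : delta_mor) : nat * nat :=
  (`|(delta_src a).1 - (delta_rng a).1|%N,
   `|(delta_src a).2 - (delta_rng a).2|%N).

Definition dmor (m n : int * int) (le_mn : lez2 m n) : delta_mor :=
  exist _ (m, n) le_mn.

Lemma lez2_refl n : lez2 n n. Proof. by rewrite /lez2 !lexx. Qed.

Lemma lez2_trans n m p : lez2 m n -> lez2 n p -> lez2 m p.
Proof.
by move=> /andP[a b] /andP[c d]; rewrite /lez2 (le_trans a c) (le_trans b d).
Qed.

Lemma lez2_addn n (d : nat * nat) : lez2 n (n + intz2 d).
Proof. by rewrite /lez2 /= !lerDl. Qed.

Lemma lez2_addr p m n : lez2 m n -> lez2 (m + p) (n + p).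
Proof. by move=> /andP[a b]; rewrite /lez2 /= !lerD2r a b. Qed.

Lemma delta_compP (a b : delta_mor) :
  delta_src a = delta_rng b -> lez2 (delta_rng a) (delta_src b).
Proof.
have le_a : lez2 (delta_rng a) (delta_src a) := valP a.
by move=> e; rewrite e in le_a; exact: lez2_trans le_a (valP b).
Qed.

Definition delta_comp (a b : delta_mor) : option delta_mor :=
  match @eqP _ (delta_src a) (delta_rng b) with
  | ReflectT e => Some (dmor (delta_compP e))
  | ReflectF _ => None
  end.

Definition Delta : graph2 :=
  Graph2 delta_rng delta_src (fun n => dmor (lez2_refl n)) delta_comp delta_deg.

Record basic_data := BasicData {
  tile : {fset nat * nat};
  tile0 : 0 \in tile;
  tile_hereditary : forall i j, j \in tile -> le2 i j -> i \in tile;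
  modulus : nat;
  modulus_gt1 : (1 < modulus)%N;
  trace : 'Z_modulus;
  rule : tile -> 'Z_modulus
}.

Section BasicData.
Variable D : basic_data.
Local Notation T := (tile D).
Local Notation Zq := 'Z_(modulus D).

Definition corner1 : nat := (\max_(i : T) (val i).1)%N.
Definition corner2 : nat := (\max_(i : T) (val i).2)%N.

Lemma card_tile_gt0 : (0 < #|{: T}|)%N.
Proof. by apply/card_gt0P; exists [` tile0 D]%fset. Qed.

Lemma corner1_in : (corner1, 0%N) \in T.
Proof.
have [i e] := bigop.eq_bigmax (fun i : T => (val i).1) card_tile_gt0.
by apply: (tile_hereditary (valP i)); rewrite /corner1 e /le2 leqnn.
Qed.

Lemma corner2_in : (0%N, corner2) \in T.
Proof.
have [i e] := bigop.eq_bigmax (fun i : T => (val i).2) card_tile_gt0.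
by apply: (tile_hereditary (valP i)); rewrite /corner2 e /le2 leqnn.
Qed.

Definition invertible_corners : Prop :=
  rule [` corner1_in]%fset \is a GRing.unit /\
  rule [` corner2_in]%fset \is a GRing.unit.

Definition is_vertex (v : {ffun T -> Zq}) : bool :=
  \sum_(i : T) rule i * v i == trace D.

Definition vertex : Type := {v : {ffun T -> Zq} | is_vertex v}.

(* box n is {m | 0 <= m <= n} and T(n) is translates n. *)
Definition box (n : nat * nat) : {fset nat * nat} :=
  [fset ((a, b) : nat * nat) | a in iota 0 n.1.+1, b in iota 0 n.2.+1]%fset.

Definition translates (n : nat * nat) : {fset nat * nat} :=
  [fset (i + m)%R | i in T, m in box n]%fset.

Lemma in_box m n : (m \in box n) = le2 m n.
Proof.
have memi k N : (k \in iota 0 N.+1) = (k <= N)%N by rewrite mem_iota ltnS.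
apply/imfset2P/idP => [[a ha [b hb ->]]|/andP[ha hb]].
  by rewrite /le2 -!memi; apply/andP; split; [exact: ha | exact: hb].
exists m.1; first by rewrite -memi in ha.
by exists m.2; [rewrite -memi in hb | case: (m)].
Qed.

Lemma mem_translates i m n : i \in T -> le2 m n -> i + m \in translates n.
Proof.
by move=> iT mn; apply/imfset2P; exists i => //; exists m; rewrite //= in_box.
Qed.

Lemma translatesP x n :
  x \in translates n -> exists i m, [/\ i \in T, le2 m n & x = i + m].
Proof.
by case/imfset2P=> i /= iT [m]; rewrite in_box => mn ->; exists i, m.
Qed.

(* f|_{T+m}, viewed as a function on T. *)
Definition restr n (f : {ffun translates n -> Zq}) m (le_mn : le2 m n) :
    {ffun T -> Zq} :=
  [ffun i : T => f [` mem_translates (valP i) le_mn]%fset].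

Lemma box_le n (m : box n) : le2 (val m) n.
Proof. by rewrite -in_box (valP m). Qed.

Definition is_path n (f : {ffun translates n -> Zq}) : bool :=
  [forall m : box n, is_vertex (restr f (box_le m))].

Definition path_of n : Type := {f : {ffun translates n -> Zq} | is_path f}.

HB.instance Definition _ n := Finite.on (path_of n).

Lemma is_pathP n (f : {ffun translates n -> Zq}) :
  reflect (forall m (le_mn : le2 m n), is_vertex (restr f le_mn)) (is_path f).
Proof.
apply: (iffP forallP) => [fP m le_mn|fP m]; last exact: fP.
have mb : m \in box n by rewrite in_box.
have := fP [` mb]%fset; set le' := box_le _.
by rewrite (bool_irrelevance le' le_mn).
Qed.

Definition path_vertex n (lam : path_of n) m (le_mn : le2 m n) : vertex :=
  exist is_vertex (restr (val lam) le_mn) (elimT (is_pathP _) (valP lam) m le_mn).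

Definition path_range n (lam : path_of n) : vertex := path_vertex lam (le02 n).
Definition path_source n (lam : path_of n) : vertex := path_vertex lam (le2_refl n).

Lemma segment_mem p m n i : le2 m n -> le2 n p ->
  i \in translates (sub2 n m) -> m + i \in translates p.
Proof.
move=> /andP[m1 m2] /andP[n1 n2] /translatesP[j [k [jT /andP[k1 k2] ->]]].
rewrite addrCA; apply: mem_translates => //.
by rewrite /le2 /= !(leq_trans _ n1, leq_trans _ n2) // -leq_subRL.
Qed.

Definition segment_fun p (f : {ffun translates p -> Zq}) m n
    (le_mn : le2 m n) (le_np : le2 n p) :
    {ffun translates (sub2 n m) -> Zq} :=
  [ffun i : translates (sub2 n m) =>
    f [` segment_mem le_mn le_np (valP i)]%fset].

Lemma segment_path p (lam : path_of p) m n (le_mn : le2 m n)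
  (le_np : le2 n p) : is_path (segment_fun (val lam) le_mn le_np).
Proof.
apply/is_pathP => k le_k.
have le_mk : le2 (m + k) p.
  move: le_mn le_np le_k => /andP[m1 m2] /andP[n1 n2] /andP[k1 k2].
  by rewrite /le2 /= !(leq_trans _ n1, leq_trans _ n2) // -leq_subRL.
have := elimT (is_pathP _) (valP lam) _ le_mk; congr is_vertex.
apply/ffunP => i; rewrite !ffunE; congr (_ _); apply: val_inj => /=.
by rewrite addrCA.
Qed.

Definition segment p (lam : path_of p) m n (le_mn : le2 m n)
    (le_np : le2 n p) : path_of (sub2 n m) :=
  exist (@is_path _) _ (segment_path lam le_mn le_np).

Definition lambda_mor : Type := {n : nat * nat & path_of n}.
HB.instance Definition _ := Choice.on lambda_mor.

Definition lpath n (lam : path_of n) : lambda_mor := Tagged path_of lam.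

Lemma translates0 x : x \in translates 0 -> x \in T.
Proof.
case/translatesP=> -[i1 i2] [[m1 m2] [iT /andP[/=]]].
by rewrite !leqn0 => /eqP-> /eqP-> ->; rewrite addr0.
Qed.

Definition id_fun (v : vertex) : {ffun translates 0 -> Zq} :=
  [ffun i : translates 0 => val v [` translates0 (valP i)]%fset].

Lemma id_path v : is_path (id_fun v).
Proof.
apply/is_pathP => -[m1 m2] le_m0; have := valP v; congr is_vertex.
apply/ffunP => i; rewrite !ffunE; congr (_ _); apply: val_inj => /=.
by case/andP: le_m0 => /=; rewrite !leqn0 => /eqP-> /eqP->; rewrite addr0.
Qed.

Definition lambda_id (v : vertex) : lambda_mor := lpath (exist (@is_path 0) _ (id_path v)).

Definition lambda_rng (lam : lambda_mor) : vertex := path_range (tagged lam).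
Definition lambda_src (lam : lambda_mor) : vertex := path_source (tagged lam).

(* lam(0,m) = mu and lam(m,m+n) = nu, compared in the total space of paths since
   m - 0 and (m + n) - m are only propositionally equal to m and n. *)
Definition is_composite m n (mu : path_of m) (nu : path_of n)
    (lam : path_of (m + n)) : bool :=
  (lpath (segment lam (le02 m) (le2_addr m n)) == lpath mu) &&
  (lpath (segment lam (le2_addr m n) (le2_refl (m + n))) == lpath nu).

(* If the rule has invertible corners and s(mu) = r(nu) there is exactly one
   candidate for [pick] to return. *)
Definition lambda_comp (mu nu : lambda_mor) : option lambda_mor :=
  if lambda_src mu == lambda_rng nu then
    omap (@lpath _)
      [pick lam : path_of (tag mu + tag nu)
        | is_composite (tagged mu) (tagged nu) lam]
  else None.

Definition Lambda : graph2 :=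
  Graph2 lambda_rng lambda_src lambda_id lambda_comp (fun lam => tag lam).

Definition path_space : Type := dfunctor Delta Lambda.

HB.instance Definition _ := gen_eqMixin path_space.
HB.instance Definition _ := gen_choiceMixin path_space.

Definition cylinder (lam : lambda_mor) (n : int * int) : set path_space :=
  [set x | x (dmor (lez2_addn n (tag lam))) = lam].

Definition cylinders : set (set path_space) :=
  [set U | exists lam n, U = cylinder lam n].

Lemma lambda_comp_inj mu nu mu' nu' lam :
  lambda_comp mu nu = Some lam -> lambda_comp mu' nu' = Some lam ->
  tag mu = tag mu' -> tag nu = tag nu' -> mu = mu' /\ nu = nu'.
Proof.
case: mu nu mu' nu' => [m mu] [n nu] [m' mu'] [n' nu'].
move=> + + /= em en; subst m' n'; rewrite /lambda_comp /=.
case: eqP => // _; case: pickP => //= l lP [<-].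
case: eqP => // _; case: pickP => //= l' l'P [ll'].
move/eqP: ll'; rewrite eq_Tagged /= => /eqP ll'; subst l'.
move: lP l'P => /andP[/eqP e1 /eqP e2] /andP[/eqP e1' /eqP e2'].
by split; [exact: etrans (esym e1) e1' | exact: etrans (esym e2) e2'].
Qed.

Lemma delta_comp_dmor m n p (mn : lez2 m n) (np : lez2 n p) (mp : lez2 m p) :
  delta_comp (dmor mn) (dmor np) = Some (dmor mp).
Proof.
rewrite /delta_comp; case: eqP => // e.
by congr Some; apply: val_inj.
Qed.

Lemma path_space_sub (x y : path_space) a b n p
    (ab : lez2 a b) (an : lez2 a n) (np : lez2 n p) (pb : lez2 p b) :
  x (dmor ab) = y (dmor ab) -> x (dmor np) = y (dmor np).
Proof.
have nb := lez2_trans np pb => e.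
have tagE u : tag (x u) = tag (y u).
  exact: etrans (fmor_deg x u) (esym (fmor_deg y u)).
have split_at m q r (mq : lez2 m q) (qr : lez2 q r) (mr : lez2 m r) :
    x (dmor mr) = y (dmor mr) ->
    x (dmor mq) = y (dmor mq) /\ x (dmor qr) = y (dmor qr).
  move=> emr; have cE := delta_comp_dmor mq qr mr.
  have cx := fmor_comp x cE; have cy := fmor_comp y cE; rewrite -emr in cy.
  exact: lambda_comp_inj cx cy (tagE _) (tagE _).
by have [_ /(split_at _ _ _ np pb nb)[]] := split_at _ _ _ an nb ab e.
Qed.

Lemma cylinders_cover : \bigcup_(U in cylinders) U = setT.
Proof.
apply/seteqP; split=> // x _.
pose u := dmor (lez2_addn 0 0); exists (cylinder (x u) 0); first by exists (x u), 0.
rewrite /cylinder /=; congr (x _); apply: val_inj => /=.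
by rewrite (_ : tag (x u) = delta_deg u); last exact: (fmor_deg x u).
Qed.

Lemma cylinders_join (U V : set path_space) x :
  cylinders U -> cylinders V -> U x -> V x ->
  exists W, [/\ cylinders W, W x & W `<=` U `&` V].
Proof.
move=> [l [n ->]] [l' [n' ->]] xl xl'.
pose a : int * int := (Order.min n.1 n'.1, Order.min n.2 n'.2).
pose p := n + intz2 (tag l); pose p' := n' + intz2 (tag l').
pose d : nat * nat := (`|Num.max p.1 p'.1 - a.1|%N, `|Num.max p.2 p'.2 - a.2|%N).
pose np : lez2 n p := lez2_addn _ _.
pose np' : lez2 n' p' := lez2_addn _ _.
have an : lez2 a n by rewrite /lez2 /= !ge_min !lexx.
have an' : lez2 a n' by rewrite /lez2 /= !ge_min !lexx !orbT.
have bE : a + intz2 d = (Num.max p.1 p'.1, Num.max p.2 p'.2).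
  have [/andP[h1 h2] /andP[h3 h4]] := (lez2_trans an np, lez2_trans an' np').
  have aE (k j : int) : k <= j -> k + `|j - k|%N%:Z = j.
    by move=> kj; rewrite gez0_abs ?subr_ge0 // subrKC.
  rewrite [LHS]surjective_pairing /d; congr (_, _); apply: aE;
    by rewrite le_max ?h1 ?h2.
have pb : lez2 p (a + intz2 d) by rewrite bE /lez2 /= !le_max !lexx.
have pb' : lez2 p' (a + intz2 d) by rewrite bE /lez2 /= !le_max !lexx !orbT.
pose u := dmor (lez2_addn a d).
have tu : tag (x u) = d.
  rewrite (_ : tag (x u) = delta_deg u); last exact: (fmor_deg x u).
  by rewrite /delta_deg /= ![_ + _ - _]addrAC !subrr !add0r.
have uE : dmor (lez2_addn a (tag (x u))) = u by apply: val_inj; rewrite /= tu.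
have WE : cylinder (x u) a = [set y | y u = x u] by rewrite /cylinder uE.
exists (cylinder (x u) a); split; first by exists (x u), a.
  by rewrite WE.
rewrite WE => y /= yx; split; rewrite /cylinder /=.
- rewrite -[RHS]xl; exact: (path_space_sub an np pb yx).
- rewrite -[RHS]xl'; exact: path_space_sub an' np' pb' yx.
Qed.

HB.instance Definition _ :=
  isBaseTopological.Build path_space cylinders_cover cylinders_join.

Definition delta_shift p (a : mor2 Delta) : mor2 Delta :=
  dmor (lez2_addr p (valP a)).

Lemma delta_shift_comp p a b c : delta_comp a b = Some c ->
  delta_comp (delta_shift p a) (delta_shift p b) = Some (delta_shift p c).
Proof.
rewrite {1}/delta_comp; case: eqP => // e [<-]; rewrite /delta_comp.
case: eqP => [e'|[]]; last exact: (congr1 (fun n => n + p) e).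
by congr Some; apply: val_inj.
Qed.

Lemma delta_shift_id p n :
  delta_shift p (id2 (g := Delta) n) = id2 (g := Delta) (n + p).
Proof. exact: val_inj. Qed.

Lemma delta_shift_deg p a : delta_deg (delta_shift p a) = delta_deg a.
Proof.
have cancel_p (k j r : int) : k + r - (j + r) = k - j.
  by rewrite opprD addrACA subrr addr0.
by rewrite /delta_deg /= !cancel_p.
Qed.

Definition sigma (p : int * int) (x : path_space) : path_space.
Proof.
apply: (@DFunctor Delta Lambda (fun n => fob x (n + p))
  (fun a => x (delta_shift p a))).
- by move=> a; rewrite fmor_rng.
- by move=> a; rewrite fmor_src.
- by move=> n; rewrite -fmor_id -delta_shift_id.
- by move=> a b c /(delta_shift_comp p) abc; exact: (fmor_comp x abc).
- by move=> a; exact: etrans (fmor_deg x _) (delta_shift_deg p a).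
Defined.

(* As a type, [Omega] is the subtype [set_type], with the topology induced by the
   product topology of the discrete spaces Z/qZ. *)
Definition Omega : set {ptws (int * int) -> discrete_topology Zq} :=
  [set f | forall n : int * int,
    \sum_(i : T) rule i * (f (intz2 (val i) + n) : Zq) = 0].

Lemma alpha_in (p : int * int) (f : Omega) :
  (fun n => val f (n + p)) \in Omega.
Proof.
apply/mem_set => n; rewrite -[RHS](set_mem (valP f) (n + p)).
by apply: eq_bigr => i _; rewrite addrA.
Qed.

Definition alpha (p : int * int) (f : Omega) : Omega :=
  exist (fun g => g \in Omega) _ (alpha_in p f).

End BasicData.

Arguments Omega : clear implicits.

(* Main.v *)
(* A path x is determined by its values f(n) = x(n,n)(0): for i in T the path
   x(n,n+i) takes one value at i, which read from its range is x(n,n)(i) and read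
   from its source is f(n+i).  Conversely f in Omega gives the paths
   j |-> f(m+j) on T(n-m).  They form a functor because a composite is unique:
   the difference of two candidates vanishes on the translates below m and above
   m, and spreads to the two remaining rectangles one translate at a time, since
   each new translate has a single unknown value, at an invertible corner. *)
Require Import Defs.
From mathcomp Require Import all_boot all_order all_algebra.
From mathcomp Require Import finmap.
From mathcomp Require Import boolp classical_sets functions.
From mathcomp Require Import topology.
From mathcomp Require Import zify.

Set Implicit Arguments.
Unset Strict Implicit.
Unset Printing Implicit Defensive.

Import Order.TTheory GRing.Theory Num.Theory.

Local Open Scope classical_set_scope.
Local Open Scope ring_scope.

Lemma intz2D i j : intz2 (i + j) = intz2 i + intz2 j.
Proof. by rewrite /intz2 /= !PoszD. Qed.

(** * Paths as total functions on $\mathbb N^2$, so that degrees equal only propositionally cause no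
    transport *)

Section Paths.
Variable D : basic_data.
Local Notation T := (tile D).
Local Notation Zq := 'Z_(modulus D).
Implicit Types (lam mu nu : lambda_mor D) (i j k m n : nat * nat).

(* The junk value off the domain of the path is 0. *)
Definition lval lam j : Zq :=
  if insub j is Some u then val (tagged lam) u else 0.

Lemma lval_in lam (u : translates D (tag lam)) :
  lval lam (val u) = val (tagged lam) u.
Proof. by rewrite /lval valK. Qed.

Lemma lval_lpath n (f : path_of D n) (u : translates D n) :
  lval (lpath f) (val u) = val f u.
Proof. exact: (@lval_in (lpath f)). Qed.

Lemma lambda_mor_eq lam mu : tag lam = tag mu ->
  {in translates D (tag lam), lval lam =1 lval mu} -> lam = mu.
Proof.
case: lam mu => [n f] [m g] /= e; subst m => fg.
congr (existT _ n _); apply: val_inj; apply/ffunP => u.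
by have := fg _ (valP u); rewrite !(@lval_in (existT _ n _)).
Qed.

Lemma lval_path_vertex n (f : path_of D n) m (le_mn : le2 m n) (i : T) :
  val (path_vertex f le_mn) i = lval (lpath f) (val i + m).
Proof.
by rewrite ffunE -lval_lpath.
Qed.

Lemma lval_sum lam m : le2 m (tag lam) ->
  \sum_(i : T) rule i * lval lam (val i + m) = trace D.
Proof.
case: lam => n f /= le_mn; have /eqP <- := valP (path_vertex f le_mn).
by apply: eq_bigr => i _; rewrite lval_path_vertex.
Qed.

Lemma lval_rng lam (i : T) : val (lambda_rng lam) i = lval lam (val i).
Proof. by case: lam => n f; rewrite lval_path_vertex addr0. Qed.

Lemma lval_src lam (i : T) : val (lambda_src lam) i = lval lam (val i + tag lam).
Proof. by case: lam => n f; rewrite lval_path_vertex. Qed.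

Lemma lval_segment p (f : path_of D p) m n (mn : le2 m n) (np : le2 n p) j :
  j \in translates D (sub2 n m) ->
  lval (lpath (segment f mn np)) j = lval (lpath f) (m + j).
Proof.
move=> jn; rewrite -[j]/(val [` jn]%fset) lval_lpath ffunE.
by rewrite -lval_lpath.
Qed.

Lemma lval_lambda_id (v : vertex D) (i : T) :
  lval (lambda_id v) (val i) = val v i.
Proof.
have i0 : val i \in translates D 0.
  by have := mem_translates (valP i) (le2_refl 0); rewrite addr0.
rewrite -[val i]/(val [` i0]%fset) lval_lpath ffunE.
by congr (_ _); apply: val_inj.
Qed.

Lemma add2KC m n : sub2 (m + n) m = n.
Proof. by case: n => n1 n2; rewrite /sub2 /= !addKn. Qed.

Lemma lpath_eqP n m (f : path_of D n) (g : path_of D m) : n = m ->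
  reflect {in translates D m, lval (lpath f) =1 lval (lpath g)}
          (lpath f == lpath g).
Proof.
move=> e; subst m; apply: (iffP eqP) => [-> //|fg].
exact: lambda_mor_eq.
Qed.

Lemma is_compositeP m n (f : path_of D m) (g : path_of D n)
    (l : path_of D (m + n)) :
  reflect ({in translates D m, lval (lpath l) =1 lval (lpath f)} /\
           {in translates D n, forall j,
              lval (lpath l) (m + j) = lval (lpath g) j})
          (is_composite f g l).
Proof.
have m0 : sub2 m 0 = m by rewrite /sub2 !subn0; case: (m).
apply: (iffP andP) => -[].
  move=> /(lpath_eqP _ _ m0) lf /(lpath_eqP _ _ (add2KC m n)) lg.
  split=> j jn; first by rewrite -lf // lval_segment ?add0r // m0.
  by rewrite -lg // lval_segment // add2KC.
move=> lf lg; split.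
  apply/(lpath_eqP _ _ m0) => j jm.
  by rewrite lval_segment ?add0r ?lf // m0.
apply/(lpath_eqP _ _ (add2KC m n)) => j jn.
by rewrite lval_segment ?lg // add2KC.
Qed.

Lemma lambda_compP mu nu lam : lambda_comp mu nu = Some lam ->
  {in translates D (tag mu), lval lam =1 lval mu} /\
  {in translates D (tag nu), forall j, lval lam (tag mu + j) = lval nu j}.
Proof.
rewrite /lambda_comp; case: eqP => // _; case: pickP => //= l lP [<-].
by case: mu nu l lP => [m f] [n g] l /is_compositeP.
Qed.

(** * Propagation through invertible corners and uniqueness of composites *)

Lemma corner_vanish (c : T) (F : nat * nat -> Zq) k :
  rule c \is a GRing.unit -> \sum_(i : T) rule i * F (val i + k) = 0 ->
  {in T, forall i, i != val c -> F (i + k) = 0} ->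
  {in T, forall i, F (i + k) = 0}.
Proof.
move=> wU sumF F0 i iT; have [->|] := eqVneq i (val c); last exact: F0.
(* Only the term at [c] survives in the sum, and its unit coefficient cancels. *)
move: sumF; rewrite (bigD1 c) //= big1 => [|u ne].
  by rewrite addr0 => /(congr1 ( *%R (rule c)^-1)); rewrite mulr0 mulKr.
by rewrite F0 ?mulr0 ?(valP u).
Qed.

(** By heredity, a point of [T + (a, b.+1)] with positive first tile coordinate lies in the right
    neighbour [T + (a.+1, b.+1)]. A point of the first tile column below the corner lies in
    [T + (a, b)], one step down. Only the corner remains unknown. *)
Lemma corner2_extend (F : nat * nat -> Zq) a b :
  rule [` corner2_in D]%fset \is a GRing.unit ->
  \sum_(i : T) rule i * F (val i + (a, b.+1)%N) = 0 ->
  {in T, forall i, F (i + (a.+1, b.+1)%N) = 0} ->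
  {in T, forall i, F (i + (a, b)%N) = 0} ->
  {in T, forall i, F (i + (a, b.+1)%N) = 0}.
Proof.
move=> wU sumF Fr Fd; apply: (corner_vanish wU sumF) => -[[|i1] i2] iT /= ne.
  have lt_i : (i2 < corner2 D)%N.
    rewrite ltn_neqAle; apply/andP; split; first by apply: contraNneq ne => ->.
    exact: (bigop.leq_bigmax (F := fun i : T => (val i).2) [` iT]%fset).
  rewrite (_ : _ + _ = (0, i2.+1)%N + (a, b)%N) ?Fd //.
    by apply: (tile_hereditary (corner2_in D)); rewrite /le2 /= lt_i.
  by apply: injective_projections; rewrite /=; lia.
rewrite (_ : _ + _ = (i1, i2) + (a.+1, b.+1)%N) ?Fr //.
  by apply: (tile_hereditary iT); rewrite /le2 /= leqnSn leqnn.
by apply: injective_projections; rewrite /=; lia.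
Qed.

(** The argument of [corner2_extend] with the coordinates exchanged: the known neighbours are now
    the one above and the one to the left. *)
Lemma corner1_extend (F : nat * nat -> Zq) a b :
  rule [` corner1_in D]%fset \is a GRing.unit ->
  \sum_(i : T) rule i * F (val i + (a.+1, b)%N) = 0 ->
  {in T, forall i, F (i + (a.+1, b.+1)%N) = 0} ->
  {in T, forall i, F (i + (a, b)%N) = 0} ->
  {in T, forall i, F (i + (a.+1, b)%N) = 0}.
Proof.
move=> wU sumF Fu Fl; apply: (corner_vanish wU sumF) => -[i1 [|i2]] iT /= ne.
  have lt_i : (i1 < corner1 D)%N.
    rewrite ltn_neqAle; apply/andP; split; first by apply: contraNneq ne => ->.
    exact: (bigop.leq_bigmax (F := fun i : T => (val i).1) [` iT]%fset).
  rewrite (_ : _ + _ = (i1.+1, 0)%N + (a, b)%N) ?Fl //.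
    by apply: (tile_hereditary (corner1_in D)); rewrite /le2 /= lt_i.
  by apply: injective_projections; rewrite /=; lia.
rewrite (_ : _ + _ = (i1, i2) + (a.+1, b.+1)%N) ?Fu //.
  by apply: (tile_hereditary iT); rewrite /le2 /= leqnSn leqnn.
by apply: injective_projections; rewrite /=; lia.
Qed.

Lemma vanish_extend (corners : invertible_corners D) (F : nat * nat -> Zq) m p :
  le2 m p ->
  (forall k, le2 k p -> \sum_(i : T) rule i * F (val i + k) = 0) ->
  (forall k, le2 k m -> {in T, forall i, F (i + k) = 0}) ->
  (forall k, le2 m k -> le2 k p -> {in T, forall i, F (i + k) = 0}) ->
  forall k, le2 k p -> {in T, forall i, F (i + k) = 0}.
Proof.
case: corners => w1 w2; case: m p => [m1 m2] [p1 p2] /andP[/= mp1 mp2] eqF Fl Fr.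
(* Columns are treated leftwards from [m1] and, within each column, rows upwards from [m2], so the
   right and lower neighbours are always settled first. The base cases are [Fr] for [d = 0] and [Fl]
   for [e = 0]. *)
have upper d b : (m2 <= b <= p2)%N ->
    {in T, forall i, F (i + (m1 - d, b)%N) = 0}.
  move=> bP; have [e be] : exists e, b = (m2 + e)%N.
    by exists (b - m2)%N; lia.
  subst b; elim: d e bP => [|d IHd] e bP.
    by apply: Fr; rewrite /le2 /=; lia.
  elim: e bP => [|e IHe] bP; first by apply: Fl; rewrite /le2 /=; lia.
  (* Subtraction is truncated: once [m1 <= d], column [m1 - d.+1] is column [m1 - d], already
     treated. *)
  have [m1d|m1d] := leqP m1 d.
    by rewrite (_ : m1 - d.+1 = m1 - d)%N; [exact: IHd | lia].
  rewrite addnS; apply: corner2_extend => //.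
  - by apply: eqF; rewrite /le2 /=; lia.
  - by have := IHd e.+1 bP; rewrite addnS (_ : (m1 - d = (m1 - d.+1).+1)%N) //; lia.
  - by apply: IHe; lia.
(* The same double induction with rows and columns exchanged. *)
have lower d a : (m1 <= a <= p1)%N ->
    {in T, forall i, F (i + (a, m2 - d)%N) = 0}.
  move=> aP; have [e ae] : exists e, a = (m1 + e)%N.
    by exists (a - m1)%N; lia.
  subst a; elim: d e aP => [|d IHd] e aP.
    by apply: Fr; rewrite /le2 /=; lia.
  elim: e aP => [|e IHe] aP; first by apply: Fl; rewrite /le2 /=; lia.
  have [m2d|m2d] := leqP m2 d.
    by rewrite (_ : m2 - d.+1 = m2 - d)%N; [exact: IHd | lia].
  rewrite addnS; apply: corner1_extend => //.
  - by apply: eqF; rewrite /le2 /=; lia.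
  - by have := IHd e.+1 aP; rewrite addnS (_ : (m2 - d = (m2 - d.+1).+1)%N) //; lia.
  - by apply: IHe; lia.
(* The point [m] cuts the box of [p] into four quadrants, covered by [Fl], [Fr], [upper] and
   [lower]. *)
move=> [a b] /andP[/= ap bp].
have [am|ma] := leqP a m1; last first.
  have [bm|mb] := leqP b m2; last by apply: Fr; rewrite /le2 /=; lia.
  by rewrite -(subKn bm); apply: lower; lia.
have [bm|mb] := leqP b m2; first by apply: Fl; rewrite /le2 /=; lia.
by rewrite -(subKn am); apply: upper; lia.
Qed.

Lemma composite_unique (corners : invertible_corners D) m n
    (f : path_of D m) (g : path_of D n) (l l' : path_of D (m + n)) :
  is_composite f g l -> is_composite f g l' -> l = l'.
Proof.
move=> /is_compositeP[lf lg] /is_compositeP[l'f l'g].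
pose F j := lval (lpath l) j - lval (lpath l') j.
have F0 : forall k, le2 k (m + n) -> {in T, forall i, F (i + k) = 0}.
  apply: (vanish_extend corners (le2_addr m n)) => k.
  (* Both paths have the same sum, the trace, so their difference satisfies the homogeneous
     equation. *)
  - move=> kp; rewrite -[RHS](subrr (trace D)).
    rewrite -{1}(@lval_sum (lpath l) k) // -(@lval_sum (lpath l') k) //.
    by rewrite -sumrB; apply: eq_bigr => i _; rewrite mulrBr.
  - move=> km i iT; have ik := mem_translates iT km.
    by rewrite /F lf // l'f // subrr.
  - move=> mk kp i iT.
    have mkE : k = m + sub2 k m.
      by case/andP: mk => ? ?; apply: injective_projections; rewrite /=; lia.
    have kn : le2 (sub2 k m) n by case/andP: kp => /= ? ?; rewrite /le2 /=; lia.
    have ik := mem_translates iT kn.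
    by rewrite mkE addrCA /F lg // l'g // subrr.
apply/val_inj/ffunP => u; rewrite -!lval_lpath.
have [i [k [iT kp ->]]] := translatesP (valP u).
by apply/eqP; rewrite -subr_eq0; apply/eqP; exact: F0.
Qed.

Lemma translates_addr m n j : j \in translates D m -> j \in translates D (m + n).
Proof.
move=> /translatesP[i [k [iT km ->]]]; apply: mem_translates iT _.
by move: km; rewrite /le2 /=; lia.
Qed.

Lemma translates_addl m n j : j \in translates D n -> m + j \in translates D (m + n).
Proof.
move=> /translatesP[i [k [iT km ->]]]; rewrite addrCA.
by apply: mem_translates iT _; move: km; rewrite /le2 /=; lia.
Qed.

(** The candidate [lam] shows that [pick] succeeds, and uniqueness identifies whatever it returns
    with [lam]. *)
Lemma lambda_compE (corners : invertible_corners D) mu nu lam :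
  tag lam = tag mu + tag nu -> lambda_src mu = lambda_rng nu ->
  {in translates D (tag mu), lval lam =1 lval mu} ->
  {in translates D (tag nu), forall j, lval lam (tag mu + j) = lval nu j} ->
  lambda_comp mu nu = Some lam.
Proof.
case: mu nu lam => [m f] [n g] [p l] /= pE; subst p => fg lf lg.
rewrite /lambda_comp fg eqxx; have lP : is_composite f g l by apply/is_compositeP.
case: pickP => [l' l'P|/(_ l)]; last by rewrite /= lP.
by rewrite /= (composite_unique corners lP l'P).
Qed.

End Paths.

(** * Degrees and composition in [Delta] *)

Lemma intz2_inj : injective intz2.
Proof. by case=> [? ?] [? ?] [-> ->]. Qed.

Lemma delta_srcE (a : delta_mor) : delta_src a = intz2 (delta_deg a) + delta_rng a.
Proof.
have /andP[a1 a2] := valP a.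
by apply: injective_projections; rewrite /= gez0_abs ?subr_ge0 ?subrK.
Qed.

Lemma delta_comp_Some a b c : delta_comp a b = Some c ->
  [/\ delta_src a = delta_rng b, delta_rng c = delta_rng a
    & delta_deg c = delta_deg a + delta_deg b].
Proof.
rewrite /delta_comp; case: eqP => // e [<-]; split=> //.
(* Degrees are compared in $\mathbb Z^2$ after adding the common range, where both sides become the
   source of [b]. *)
apply/intz2_inj/(addIr (delta_rng a)); rewrite -[LHS]delta_srcE.
by rewrite -[LHS]/(delta_src b) delta_srcE -e delta_srcE intz2D addrCA addrA.
Qed.

(** * From a configuration in [Omega] to a functor on [Delta] *)

Section Windows.
Variable D : basic_data.
Hypothesis trace0 : trace D = 0.
Local Notation T := (tile D).
Local Notation Zq := 'Z_(modulus D).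
Variable f : Omega D.

Definition window_fun (a : int * int) n : {ffun translates D n -> Zq} :=
  [ffun u => val f (intz2 (val u) + a)].

Lemma window_path a n : is_path (window_fun a n).
Proof.
apply/is_pathP => m mn; rewrite /is_vertex trace0; apply/eqP.
rewrite -[RHS](set_mem (valP f) (intz2 m + a)); apply: eq_bigr => i _.
by rewrite !ffunE /= intz2D addrA.
Qed.

Definition window a n : lambda_mor D :=
  lpath (exist (fun g => is_path g) _ (window_path a n)).

Lemma lval_window a n j :
  j \in translates D n -> lval (window a n) j = val f (intz2 j + a).
Proof.
by move=> jn; rewrite -[j]/(val [` jn]%fset) lval_lpath ffunE.
Qed.

Lemma tile_translates (i : T) m n : le2 m n -> val i + m \in translates D n.
Proof. exact: mem_translates (valP i). Qed.

Lemma window_rng a n (i : T) :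
  val (lambda_rng (window a n)) i = val f (intz2 (val i) + a).
Proof.
by rewrite lval_rng lval_window // -[val i]addr0 tile_translates.
Qed.

Lemma window_src a n (i : T) :
  val (lambda_src (window a n)) i = val f (intz2 (val i) + (intz2 n + a)).
Proof.
by rewrite lval_src lval_window ?tile_translates ?le2_refl // intz2D addrA.
Qed.

Definition window_vertex a : vertex D := lambda_rng (window a 0).

(** Composites are preserved because adjacent windows are read off the same [f], which provides the
    candidate for [lambda_compE]. It is kept transparent so that its object and morphism maps
    compute later on. *)
Definition window_functor (corners : invertible_corners D) : path_space D.
Proof.
apply: (@DFunctor Delta (Lambda D) window_vertex
  (fun a => window (delta_rng a) (delta_deg a))) => //.
- by move=> a; apply/val_inj/ffunP => i; rewrite !window_rng.
- by move=> a; apply/val_inj/ffunP => i; rewrite window_src window_rng -delta_srcE.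
- move=> v; apply: lambda_mor_eq => [|j].
    by rewrite /delta_deg /delta_src /delta_rng /= !subrr.
  rewrite {1}/delta_deg /delta_src /delta_rng /= !subrr => j0.
  have jT := translates0 j0.
  rewrite -[j in RHS]/(val [` jT]%fset) lval_lambda_id window_rng.
  by rewrite lval_window // /delta_deg /delta_src /delta_rng /= !subrr.
- move=> a b c /delta_comp_Some[ab ca ->] /=; rewrite ca.
  apply: (lambda_compE corners) => //.
  + by apply/val_inj/ffunP => i; rewrite window_src window_rng -delta_srcE ab.
  + move=> j ja; rewrite !lval_window //.
    exact: translates_addr.
  + move=> j jb; rewrite !lval_window ?translates_addl //.
    by rewrite intz2D -ab delta_srcE addrA [intz2 j + _]addrC.
Defined.

End Windows.

(** * From an infinite path to a configuration in [Omega] *)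

Section PathSpace.
Variable D : basic_data.
Local Notation T := (tile D).
Local Notation Zq := 'Z_(modulus D).
Implicit Types (x y : path_space D).

Definition origin_value x (n : int * int) : Zq := val (fob x n) [` tile0 D]%fset.

Lemma tag_fmor x a : tag (x a) = delta_deg a.
Proof. exact: (fmor_deg x a). Qed.

Lemma delta_deg_addn n d : delta_deg (dmor (lez2_addn n d)) = d.
Proof. by rewrite /delta_deg /= ![_ + _ - _]addrAC !subrr !add0r; case: d. Qed.

Lemma fob_origin_value x n (i : T) :
  val (fob x n) i = origin_value x (intz2 (val i) + n).
Proof.
pose a := dmor (lez2_addn n (val i)).
have tE : tag (x a) = val i by rewrite tag_fmor delta_deg_addn.
have <- : lambda_rng (x a) = fob x n := fmor_rng x a.
rewrite /origin_value addrC.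
have <- : lambda_src (x a) = fob x (n + intz2 (val i)) := fmor_src x a.
by rewrite lval_rng lval_src tE add0r.
Qed.

(** For [j = i + k] with [i] in the tile, cut [a] at [delta_rng a + k]. The value at [j] is then the
    value at [i] of the range of the second factor, which [fob_origin_value] computes. *)
Lemma lval_fmor x a : {in translates D (delta_deg a), forall j,
  lval (x a) j = origin_value x (intz2 j + delta_rng a)}.
Proof.
move=> _ /translatesP[i [k [iT ka ->]]].
have kc : lez2 (delta_rng a + intz2 k) (delta_src a).
  move: ka => /andP[k1 k2]; rewrite delta_srcE addrC.
  by rewrite /lez2 /= !lerD2r !lez_nat k1 k2.
pose b := dmor (lez2_addn (delta_rng a) k); pose c := dmor kc.
have abc : delta_comp b c = Some a.
  rewrite (delta_comp_dmor _ _ (valP a : lez2 (delta_rng a) (delta_src a))).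
  by congr Some; apply: val_inj; exact: esym (surjective_pairing _).
have [_] := lambda_compP (fmor_comp x abc).
have -> : tag (x b) = k by rewrite tag_fmor delta_deg_addn.
move=> /(_ i); rewrite [i + k]addrC => ->; last first.
  have := mem_translates iT (le02 (tag (x c))).
  by rewrite addr0.
rewrite -[i]/(val [` iT]%fset) -lval_rng.
have -> : lambda_rng (x c) = fob x (delta_rng c) := fmor_rng x c.
by rewrite fob_origin_value intz2D -addrA addrCA [intz2 k + _]addrC.
Qed.

Lemma path_space_eq x y : origin_value x =1 origin_value y -> x = y.
Proof.
move=> xy.
have obE : fob x = fob y.
  by apply/funext => n; apply/val_inj/ffunP => i; rewrite !fob_origin_value xy.
have morE : fmor x = fmor y.
  apply/funext => a; apply: lambda_mor_eq; first by rewrite !tag_fmor.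
  by rewrite tag_fmor => j ja; rewrite !lval_fmor.
(* The remaining fields are propositions, so equal object and morphism maps suffice. *)
case: x y obE morE {xy} => [ox mx ? ? ? ? ?] [oy my ? ? ? ? ?] /= obE morE.
by subst oy my; congr DFunctor; exact: Prop_irrelevance.
Qed.

Lemma origin_value_Omega (trace0 : trace D = 0) x :
  (origin_value x : {ptws (int * int) -> discrete_topology Zq}) \in Omega D.
Proof.
apply/mem_set => n; rewrite -[RHS]trace0 -(eqP (valP (fob x n))).
by apply: eq_bigr => i _; rewrite fob_origin_value.
Qed.

Definition labelling (trace0 : trace D = 0) x : Omega D :=
  exist (fun g => g \in Omega D) _ (origin_value_Omega trace0 x).

(** * Continuity of the two maps *)

Lemma open_cylinder lam n : open (cylinder lam n : set (path_space D)).
Proof.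
exists [set cylinder lam n]; first by move=> _ ->; exists lam, n.
by rewrite bigcup_set1.
Qed.

(** The cylinder of the degree-zero path of [x] at [n] fixes the vertex at [n], hence its value at
    the origin. *)
Lemma origin_value_near x n :
  \forall y \near x, origin_value y n = origin_value x n.
Proof.
pose a := dmor (lez2_refl n).
have aE : dmor (lez2_addn n (tag (x a))) = a.
  apply: val_inj; rewrite /= tag_fmor /delta_deg /delta_src /delta_rng /= !subrr.
  by rewrite addr0.
have : nbhs x (cylinder (x a) n).
  apply: open_nbhs_nbhs; split; first exact: open_cylinder.
  by rewrite /cylinder /= aE.
apply: filterS => y; rewrite /cylinder /= aE => yx.
have e (z : path_space D) : fob z n = lambda_rng (z a) := esym (fmor_rng z a).
by rewrite /origin_value !e yx.
Qed.

Lemma labelling_continuous (trace0 : trace D = 0) :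
  continuous (labelling trace0).
Proof.
apply: continuous_comp_initial => x.
have FF := nbhs_filter x.
have ? := fmap_filter (set_val \o labelling trace0) (F := nbhs x).
(* The product topology is the supremum of the topologies induced by the coordinates, so one
   coordinate at a time is enough. *)
apply/cvg_sup => n.
apply/cvg_image; first by apply/seteqP; split=> // v _; exists (fun=> v).
move=> A /= /principal_filterP An.
(* The preimage of [A] under evaluation at [n]; evaluation is onto, by constant functions, so its
   image is [A] again. *)
exists (fun f => A (f n)).
  apply: filterS (origin_value_near x n) => y yx.
  rewrite /fmap /= -[_ n]/(origin_value y n) yx.
  exact: An.
apply/seteqP; split=> [v [f Af <-]|v Av]; first exact: Af.
by exists (fun=> v).
Qed.

Lemma Omega_value_near (f : Omega D) n : \forall g \near f, val g n = val f n.
Proof.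
have := @initial_continuous (set_type (Omega D)) _ set_val f.
move=> /(_ [set g | g n = val f n]); apply.
have /(_ (val f)) := @proj_continuous _ (fun=> discrete_topology Zq) n.
by move=> /(_ [set v | v = val f n]); apply; exact/principal_filterP.
Qed.

(** A cylinder constrains [f] only on the translates of a finite tile, and each of these finitely
    many values is locally constant in [f]. *)
Lemma window_functor_continuous (trace0 : trace D = 0)
    (corners : invertible_corners D) :
  continuous (fun f => window_functor trace0 f corners).
Proof.
(* An open set is a union of cylinders; [U] is one that contains the image of [f]. *)
move=> f A [B [[I sI <-] [U IU Uf] sBA]].
have [lam [n UE]] := sI _ IU.
have : \forall g \near f, forall u : translates D (tag lam),
    val g (intz2 (val u) + n) = val f (intz2 (val u) + n).
  apply: (@filter_forall _ _ _ _ (nbhs_filter f)) => u; exact: Omega_value_near.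
apply: (@filterS _ _ (nbhs_filter f)) => g gf; apply: sBA; exists U => //.
move: Uf; rewrite UE /cylinder /= delta_deg_addn => <-.
apply: lambda_mor_eq => //= j jn; rewrite !lval_window //.
exact: (gf [` jn]%fset).
Qed.

End PathSpace.

Theorem theorem4p1 (D : basic_data) (trace0 : trace D = 0)
    (corners : invertible_corners D) :
  exists h : path_space D -> Omega D,
    homeomorphism h /\
    forall (p : int * int) (x : path_space D), alpha p (h x) = h (sigma p x).
Proof.
(* Equivariance holds by computation: both sides take at [n] the origin value of [x] at [n + p]. *)
exists (labelling trace0); split=> [|p x]; last exact: val_inj.
split; first exact: labelling_continuous.
exists (fun f => window_functor trace0 f corners); split.
- move=> x; apply: path_space_eq => n; rewrite /origin_value window_rng.
  by rewrite /= [intz2 _]/(0 : int * int) add0r.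
- move=> f; apply: val_inj; apply/funext => n.
  by rewrite /= /origin_value window_rng [intz2 _]/(0 : int * int) add0r.
exact: window_functor_continuous.
Qed.
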